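(* Suppose that Assumption (A2) (see context) is strictly satisfied at a strong local minimum $x^\star$ of $\varphi$, and consider the iterates generated by the algorithm ZeroFPR (see context). Suppose that $(x^k)_{k\in\mathbb{N}}$ converges to $x^\star$ and that the directions $(d^k)_{k\in\mathbb{N}}$ satisfy the Dennis–Moré condition $$\lim_{k\to\infty}\frac{\|\bar r^k+JR_\gamma(x^\star)d^k\|}{\|d^k\|}=0,\qquad\text{where }\bar r^k\in R_\gamma(\bar x^k).$$ Then, eventually stepsize $\tau_k=1$ is always accepted, and the sequences $(x^k)_{k\in\mathbb{N}}$, $(\bar x^k)_{k\in\mathbb{N}}$ and $(r^k)_{k\in\mathbb{N}}$ converge with superlinear rate.
   Context: Standing assumptions: $f:\mathbb{R}^n\to\mathbb{R}$ is differentiable with Lipschitz continuous gradient, $L_f$ denoting the Lipschitz modulus of $\nabla f$ (with $1/L_f=+\infty$ if $L_f=0$); $g:\mathbb{R}^n\to\mathbb{R}\cup\{+\infty\}$ is proper, lower semicontinuous and prox-bounded, meaning that $g+\frac{1}{2\gamma}\|\cdot\|^2$ is bounded below for some $\gamma>0$; $\gamma_g\in(0,+\infty]$ is the supremum of all such $\gamma$; $\varphi:=f+g$ and $\operatorname{argmin}\varphi\neq\emptyset$. Neither function need be convex. For $\gamma>0$: $\operatorname{prox}_{\gamma g}(y):=\operatorname{argmin}_z\{g(z)+\frac{1}{2\gamma}\|z-y\|^2\}$; $T_\gamma(x):=\operatorname{prox}_{\gamma g}(x-\gamma\nabla f(x))$ and $R_\gamma(x):=\frac1\gamma(x-T_\gamma(x))$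 (set-valued maps); $\varphi_\gamma(x):=\inf_{z}\{f(x)+\langle\nabla f(x),z-x\rangle+\frac{1}{2\gamma}\|z-x\|^2+g(z)\}$. $JR_\gamma(x^\star)$ is the Jacobian of $R_\gamma$ at $x^\star$. A point $x^\star\in\operatorname{dom}\varphi$ is critical if $x^\star\in T_{\gamma'}(x^\star)$ for some $\gamma'\in(0,\gamma_g)$. Algorithm ZeroFPR. Parameters: $\gamma\in(0,\min\{1/L_f,\gamma_g\})$, $\beta,p_{\min}\in(0,1)$, $\sigma\in(0,\gamma\frac{1-\gamma L_f}{2})$, $x^0\in\mathbb{R}^n$; $\bar\Phi_0=\varphi_\gamma(x^0)$. For $k=0,1,2,\dots$: (1) select $\bar x^k\in T_\gamma(x^k)$ and set $r^k=\frac1\gamma(x^k-\bar x^k)$; (2) if $r^k=0$ stop; (3) select a direction $d^k\in\mathbb{R}^n$; (4) let $\tau_k$ be the largest element of $\{\beta^m:m\in\mathbb{N}\}$ ($m\ge0$) such that $x^{k+1}=\bar x^k+\tau_kd^k$ satisfies $\varphi_\gamma(x^{k+1})\le\bar\Phi_k-\sigma\|r^k\|^2$; (5) set $\bar\Phi_{k+1}=(1-p_k)\bar\Phi_k+p_k\varphi_\gamma(x^{k+1})$ for some $p_k\in[p_{\min},1]$. It is assumed throughout that $r^k\ne0$ for all $k$, so that infinite sequences are generated. A sequence $(w^k)$ with $w^k\neq w^\star$ for all $k$ converges superlinearly to $w^\star$ if $\|w^{k+1}-w^\star\|/\|w^k-w^\star\|\to0$. A strong local minimum $x^\star$ of $h$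 is a point for which there are $c>0$ and a neighborhood $U$ of $x^\star$ with $h(x)\ge h(x^\star)+c\|x-x^\star\|^2$ for all $x\in U$. $\partial g$ is the limiting subdifferential: $v\in\partial g(x)$ iff there are $x^j\to x$ with $g(x^j)\to g(x)$ and $v^j\to v$ with $v^j$ a regular (Fréchet) subgradient of $g$ at $x^j$. $g$ is prox-regular at $x_0$ for $v_0\in\partial g(x_0)$ if there exist $\rho,\varepsilon>0$ such that $g(x')\ge g(x)+\langle v,x'-x\rangle-\frac\rho2\|x'-x\|^2$ for all $x'\in B(x_0;\varepsilon)$ and all $(x,v)$ with $v\in\partial g(x)$, $x\in B(x_0;\varepsilon)$, $v\in B(v_0;\varepsilon)$, $g(x)\le g(x_0)+\varepsilon$. For $v\in\partial g(x)$ and $\tau>0$ let $\Delta^2_\tau g(x|v)[d]:=\frac{g(x+\tau d)-g(x)-\tau\langle v,d\rangle}{\tau^2/2}$. $g$ is twice epi-differentiable at $x$ for $v$ if $\Delta^2_\tau g(x|v)$ epi-converges as $\tau\searrow0$ to a proper function, denoted $\mathrm{d}^2g(x|v)[\cdot]$; strictly twice epi-differentiable at $x$ for $v$ if $\Delta^2_\tau g(x'|v')$ epi-converges as $\tau\searrow0$ and $(x',v')\to(x,v)$ with $v'\in\partial g(x')$, $g(x')\to g(x)$. Assumption (A2) is strictly satisfied at (with respect to) a critical point $x^\star$ if: $\nabla^2f$ exists and is strictly continuous (i.e. locally Lipschitz) around $x^\star$; and $g$ is prox-regular and strictly twice epi-differentiable at $x^\star$ for $-\nabla f(x^\star)$,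 with $\mathrm{d}^2g(x^\star|-\nabla f(x^\star))[d]=\langle d,Md\rangle+\delta_S(d)$ for all $d\in\mathbb{R}^n$, where $S\subseteq\mathbb{R}^n$ is a linear subspace, $\delta_S$ its indicator function ($0$ on $S$, $+\infty$ elsewhere), and $M\in\mathbb{R}^{n\times n}$; without loss of generality $M$ is symmetric with $\operatorname{Im}(M)\subseteq S$ and $\ker(M)\supseteq S^\perp$. *)

(* Defs.v *)
From HB Require Import structures.
From mathcomp Require Import all_boot all_order all_algebra.
From mathcomp Require Import all_classical all_reals all_analysis.

Set Implicit Arguments.
Unset Strict Implicit.
Unset Printing Implicit Defensive.

Import Order.TTheory GRing.Theory Num.Theory.
Import numFieldNormedType.Exports.

Local Open Scope classical_set_scope.
Local Open Scope ring_scope.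

Section Euclidean.
Context {R : realType} {n : nat}.
Implicit Types u v x y : 'rV[R]_n.

Definition dotv u v : R := \sum_i u 0 i * v 0 i.

(* The norm `|u| of the library on 'rV[R]_n is the sup norm.  It induces the
   same topology as [enorm], so limits and neighborhoods are the library's. *)
Definition enorm u : R := Num.sqrt (dotv u u).

Definition grad (f : 'rV[R]_n -> R) x : 'rV[R]_n :=
  \row_i 'D_(delta_mx 0 i) f x.

Definition lip_const (F : 'rV[R]_n -> 'rV[R]_n) (L : R) :=
  0 <= L /\ forall x y, enorm (F x - F y) <= L * enorm (x - y).

(* Only meaningful when F is Lipschitz: otherwise the set is empty and its
   [inf] is 0. *)
Definition lip_modulus (F : 'rV[R]_n -> 'rV[R]_n) : R :=
  inf [set L | lip_const F L].

Definition superlinear (w : nat -> 'rV[R]_n) (ws : 'rV[R]_n) :=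
  (\forall k \near \oo, w k <> ws) /\
  (fun k => enorm (w k.+1 - ws) / enorm (w k - ws)) @ \oo --> (0 : R).

End Euclidean.

Section Variational.
Context {R : realType} {n : nat}.
Local Notation E := 'rV[R]_n.
Local Open Scope ereal_scope.
Implicit Types (f : E -> R) (g h : E -> \bar R) (x y z v d : E).

Definition proper_fun h := (forall x, h x != -oo) /\ (exists x, h x < +oo).

Definition argmin h : set E := [set x | forall y, h x <= h y].

Definition bounded_below h := exists m : R, forall x, m%:E <= h x.

Definition prox_bound_params g : set R :=
  [set gamma : R | (0 < gamma)%R /\
    bounded_below (fun x => g x + ((2 * gamma)^-1 * enorm x ^+ 2)%:E)].

Definition prox_bounded g := prox_bound_params g !=set0.

Definition prox_threshold g : \bar R :=
  ereal_sup [set gamma%:E | gamma in prox_bound_params g].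

Definition cost f g : E -> \bar R := fun x => (f x)%:E + g x.

Record standing f g : Prop := Standing {
  standing_differentiable : forall x, differentiable f x;
  standing_lipschitz : exists L, lip_const (grad f) L;
  standing_proper : proper_fun g;
  standing_lsc : lower_semicontinuous g;
  standing_prox_bounded : prox_bounded g;
  standing_argmin : argmin (cost f g) !=set0 }.

Definition prox (gamma : R) g y : set E :=
  argmin (fun z => g z + ((2 * gamma)^-1 * enorm (z - y) ^+ 2)%:E).

Definition fb_step (gamma : R) f g x : set E :=
  prox gamma g (x - gamma *: grad f x)%R.

Definition fb_residual (gamma : R) f g x : set E :=
  [set gamma^-1 *: (x - z) | z in fb_step gamma f g x]%R.

Definition fb_envelope (gamma : R) f g x : \bar R :=
  ereal_inf (range (fun z : E =>
    (f x + dotv (grad f x) (z - x) + (2 * gamma)^-1 * enorm (z - x) ^+ 2)%:E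
    + g z)).

Definition critical f g x :=
  cost f g x < +oo /\
  exists gamma : R, [/\ (0 < gamma)%R, gamma%:E < prox_threshold g &
                       fb_step gamma f g x x].

Definition strong_local_min h x :=
  exists2 c : R, (0 < c)%R &
    \forall y \near x, h x + (c * enorm (y - x) ^+ 2)%:E <= h y.

(* J is the Jacobian of the set-valued map F at x: F is single-valued around x
   and the resulting function is differentiable at x with Jacobian J.  The
   matrix 'J acts on the right of row vectors: the differential is d *m J. *)
Definition has_jacobian (F : E -> set E) x (J : 'M[R]_n) :=
  exists F0 : E -> E, [/\ \forall y \near x, F y = [set F0 y],
                         differentiable F0 x & 'J F0 x = J].

Definition regular_subdiff g x : set E :=
  [set v | g x \is a fin_num /\
     forall eps : R, (0 < eps)%R -> \forall y \near x,
       g x + (dotv v (y - x) - eps * enorm (y - x))%:E <= g y].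

Definition subdiff g x : set E :=
  [set v | g x \is a fin_num /\
     exists xs vs : nat -> E,
       [/\ xs @ \oo --> x, (g \o xs) @ \oo --> g x, vs @ \oo --> v &
           forall j, regular_subdiff g (xs j) (vs j)]].

Definition prox_regular g x0 v0 :=
  subdiff g x0 v0 /\
  exists rho eps : R, [/\ (0 < rho)%R, (0 < eps)%R &
    forall x' x v, (enorm (x' - x0) < eps)%R -> (enorm (x - x0) < eps)%R ->
      (enorm (v - v0) < eps)%R -> subdiff g x v -> g x <= g x0 + eps%:E ->
      g x + (dotv v (x' - x) - rho / 2 * enorm (x' - x) ^+ 2)%:E <= g x'].

(* Pointwise description of epi-convergence (Rockafellar and Wets, Prop. 7.2) *)
Definition epi_cvg (hs : nat -> E -> \bar R) h := forall d,
  (forall ds : nat -> E, ds @ \oo --> d ->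
     h d <= limn_einf (fun j => hs j (ds j))) /\
  (exists2 ds : nat -> E, ds @ \oo --> d &
     limn_esup (fun j => hs j (ds j)) <= h d).

(* Only used when subdiff g x v holds, so that g x is finite. *)
Definition second_quotient g x v (tau : R) d : \bar R :=
  (g (x + tau *: d)%R - g x - (tau * dotv v d)%:E) * ((tau ^+ 2 / 2)^-1)%:E.

(* Epi-convergence as tau goes to 0 from the right is epi-convergence along
   all positive sequences that tend to 0. *)
Definition twice_epi_derivative g x v h :=
  [/\ subdiff g x v, proper_fun h &
      forall ts : nat -> R, (forall j, (0 < ts j)%R) -> ts @ \oo --> (0 : R)%R ->
        epi_cvg (fun j => second_quotient g x v (ts j)) h].

Definition strictly_twice_epi_differentiable g x v :=
  subdiff g x v /\
  exists h, forall (ts : nat -> R) (xs vs : nat -> E),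
    (forall j, (0 < ts j)%R) -> ts @ \oo --> (0 : R)%R ->
    xs @ \oo --> x -> vs @ \oo --> v ->
    (forall j, subdiff g (xs j) (vs j)) -> (g \o xs) @ \oo --> g x ->
    epi_cvg (fun j => second_quotient g (xs j) (vs j) (ts j)) h.

(* For row vectors, <d, M d> is the entry of d *m M *m d^T. *)
Definition quad_on_subspace (M : 'M[R]_n) (S : {vspace E}) d : \bar R :=
  if d \in S then (dotv (d *m M) d)%:E else +oo.

(* M is arbitrary: replacing it by P ((M + M^T) / 2) P, with P the orthogonal
   projection onto S, does not change [quad_on_subspace]. *)
Record A2_strict f g x : Prop := A2Strict {
  A2_critical : critical f g x;
  A2_hess_exists : \forall y \near x, differentiable (grad f) y;
  A2_hess_lipschitz : exists2 U, nbhs x U & [lipschitz 'J (grad f) y | y in U];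
  A2_prox_regular : prox_regular g x (- grad f x)%R;
  A2_strict_epi : strictly_twice_epi_differentiable g x (- grad f x)%R;
  A2_quadratic : exists (S : {vspace E}) (M : 'M[R]_n),
    twice_epi_derivative g x (- grad f x)%R (quad_on_subspace M S) }.

(* (0%:E)^-1 = +oo in \bar R, which is the convention 1 / L_f = +oo. *)
Record ZeroFPR f g (gamma beta pmin sigma : R) (p : nat -> R)
    (x xbar r d : nat -> E) (tau : nat -> R) (Phi : nat -> \bar R) : Prop :=
  MkZeroFPR {
  zfpr_gamma_gt0 : (0 < gamma)%R;
  zfpr_gamma_lt :
    gamma%:E < mine (lip_modulus (grad f))%:E^-1 (prox_threshold g);
  zfpr_beta : (0 < beta < 1)%R;
  zfpr_pmin : (0 < pmin < 1)%R;
  zfpr_sigma :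
    (0 < sigma < gamma * ((1 - gamma * lip_modulus (grad f)) / 2))%R;
  zfpr_p : forall k, (pmin <= p k <= 1)%R;
  zfpr_Phi0 : Phi 0%N = fb_envelope gamma f g (x 0%N);
  zfpr_xbar : forall k, fb_step gamma f g (x k) (xbar k);
  zfpr_r : forall k, r k = (gamma^-1 *: (x k - xbar k))%R;
  zfpr_nonstop : forall k, r k <> 0%R;
  zfpr_x : forall k, x k.+1 = (xbar k + tau k *: d k)%R;
  zfpr_tau : forall k,
    let accepted (t : R) := fb_envelope gamma f g (xbar k + t *: d k)%R
                            <= Phi k - (sigma * enorm (r k) ^+ 2)%:E in
    exists m : nat, [/\ tau k = (beta ^+ m)%R, accepted (beta ^+ m)%R &
      forall m' : nat, accepted (beta ^+ m')%R -> (beta ^+ m' <= beta ^+ m)%R];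
  zfpr_Phi : forall k, Phi k.+1 =
    (1 - p k)%:E * Phi k + (p k)%:E * fb_envelope gamma f g (x k.+1) }.

(* The quotient presupposes d k <> 0.  It has to be required explicitly, since
   division by 0 returns 0 here. *)
Definition dennis_more (J : 'M[R]_n) (rbar d : nat -> E) :=
  (\forall k \near \oo, d k <> 0%R) /\
  (fun k => enorm (rbar k + d k *m J) / enorm (d k))%R @ \oo --> (0 : R)%R.

End Variational.

(* Main.v *)
(* Comparing the infimum defining phi_gamma(y) with its objective at z in T(x)
   gives phi_gamma(y) <= phi_gamma(x) + A |y-x|^2 + B |y-x| |x-z|.  Walking from
   xstar along a direction of the kernel of J in many short steps, this
   contradicts the quadratic growth that phi_gamma inherits from phi, so J is
   nonsingular.  Nonsingularity turns the Dennis-More condition into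
   |xbar^k + d^k - xstar| = o(|xbar^k - xstar|).  Hence
   phi_gamma(xbar^k + d^k) <= phi(xstar) + o(|xbar^k - xstar|^2) <= phi(xbar^k),
   and phi(xbar^k) <= Phi_k - sigma |r^k|^2 by the descent lemma: the unit step
   is accepted. *)
Require Import Defs.
From HB Require Import structures.
From mathcomp Require Import all_boot all_order all_algebra.
From mathcomp Require Import all_classical all_reals all_analysis.
From mathcomp Require Import ring lra.
Import Order.TTheory GRing.Theory Num.Theory.
Import numFieldNormedType.Exports.
Local Open Scope classical_set_scope.
Local Open Scope ring_scope.

(** * Euclidean inner product and norm on row vectors *)

Section Euclidean.
Context {R : realType} {n : nat}.
Implicit Types (u v w x y : 'rV[R]_n) (a : R).

Lemma dotvC u v : dotv u v = dotv v u.
Proof. by apply: eq_bigr => i _; rewrite mulrC. Qed.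

Lemma dotvDl u v w : dotv (u + v) w = dotv u w + dotv v w.
Proof. by rewrite -big_split; apply: eq_bigr => i _; rewrite !mxE mulrDl. Qed.

Lemma dotvZl a u v : dotv (a *: u) v = a * dotv u v.
Proof. by rewrite /dotv mulr_sumr; apply: eq_bigr => i _; rewrite mxE mulrA. Qed.

Lemma dotvNl u v : dotv (- u) v = - dotv u v.
Proof. by rewrite -scaleN1r dotvZl mulN1r. Qed.

Lemma dotvDr u v w : dotv w (u + v) = dotv w u + dotv w v.
Proof. by rewrite !(dotvC w) dotvDl. Qed.

Lemma dotvZr a u v : dotv u (a *: v) = a * dotv u v.
Proof. by rewrite !(dotvC u) dotvZl. Qed.

Lemma dotvNr u v : dotv u (- v) = - dotv u v.
Proof. by rewrite !(dotvC u) dotvNl. Qed.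

Definition dotvE := (dotvDl, dotvDr, dotvNl, dotvNr, dotvZl, dotvZr).

Lemma dotv_ge0 u : 0 <= dotv u u.
Proof. by apply: sumr_ge0 => i _; rewrite -expr2 sqr_ge0. Qed.

Lemma enorm_ge0 u : 0 <= enorm u.
Proof. exact: sqrtr_ge0. Qed.

Lemma sqr_enorm u : enorm u ^+ 2 = dotv u u.
Proof. by rewrite sqr_sqrtr // dotv_ge0. Qed.

Lemma enormN u : enorm (- u) = enorm u.
Proof. by rewrite /enorm dotvNl dotvNr opprK. Qed.

Lemma enormBC u v : enorm (u - v) = enorm (v - u).
Proof. by rewrite -enormN opprB. Qed.

Lemma enormZ a u : enorm (a *: u) = `|a| * enorm u.
Proof.
by rewrite /enorm dotvZl dotvZr mulrA -expr2 sqrtrM ?sqr_ge0 // sqrtr_sqr.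
Qed.

Lemma ler_coord_enorm u i : `|u 0 i| <= enorm u.
Proof.
rewrite -(@ler_pXn2r _ 2) ?nnegrE ?enorm_ge0 // sqr_enorm real_normK ?num_real //.
rewrite /dotv (bigD1 i) //= -expr2 lerDl; apply: sumr_ge0 => j _.
by rewrite -expr2 sqr_ge0.
Qed.

Lemma ler_norm_enorm u : `|u| <= enorm u.
Proof.
rewrite [leLHS]mx_normrE; apply/bigmax_leP; split; first exact: enorm_ge0.
by case=> i j _ /=; rewrite ord1 ler_coord_enorm.
Qed.

Lemma enorm_eq0 u : (enorm u == 0) = (u == 0).
Proof.
apply/idP/idP => [/eqP u0|/eqP ->]; last first.
  by rewrite -(scale0r 0) enormZ normr0 mul0r.
by rewrite -normr_eq0 eq_le normr_ge0 andbT -u0 ler_norm_enorm.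
Qed.

Lemma enorm0 : enorm (0 : 'rV[R]_n) = 0.
Proof. by apply/eqP; rewrite enorm_eq0. Qed.

Lemma enorm_gt0 u : (0 < enorm u) = (u != 0).
Proof. by rewrite lt_def enorm_ge0 andbT enorm_eq0. Qed.

Lemma ler_dotv_enorm u v : dotv u v <= enorm u * enorm v.
Proof.
have [->|u0] := eqVneq u 0; first by rewrite -(scale0r 0) dotvZl enormZ normr0 !mul0r.
have [->|v0] := eqVneq v 0.
  by rewrite -(scale0r 0) dotvZr enormZ normr0 !mul0r mulr0.
have uv0 : 0 < enorm u * enorm v by rewrite mulr_gt0 ?enorm_gt0.
(* The squared norm of this vector is [2 * (enorm u * enorm v) * (enorm u * enorm v - dotv u v)], so
   its sign gives Cauchy-Schwarz. *)
have := dotv_ge0 (enorm v *: u - enorm u *: v).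
rewrite !dotvE (dotvC v u) -!sqr_enorm => h.
have {}h : 0 <= (enorm u * enorm v) * (2 * (enorm u * enorm v - dotv u v)).
  by apply: le_trans h _; rewrite le_eqVlt; apply/orP; left; apply/eqP; ring.
by rewrite pmulr_rge0 // pmulr_rge0 // subr_ge0 in h.
Qed.

Lemma ler_norm_dotv u v : `|dotv u v| <= enorm u * enorm v.
Proof.
by rewrite ler_norml ler_dotv_enorm andbT lerNl -dotvNl -(enormN u) ler_dotv_enorm.
Qed.

Lemma ler_enormD u v : enorm (u + v) <= enorm u + enorm v.
Proof.
rewrite -(@ler_pXn2r _ 2) ?nnegrE ?addr_ge0 ?enorm_ge0 //.
rewrite sqrrD !sqr_enorm !dotvE (dotvC v u).
have := ler_dotv_enorm u v; lra.
Qed.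

Lemma ler_enormB u v : enorm (u - v) <= enorm u + enorm v.
Proof. by rewrite -(enormN v) ler_enormD. Qed.

Lemma enorm_bound_coord u (b : R) : 0 <= b -> (forall i, `|u 0 i| <= b) ->
  enorm u <= Num.sqrt n%:R * b.
Proof.
move=> b0 ub; rewrite -(@ler_pXn2r _ 2) ?nnegrE ?enorm_ge0 ?mulr_ge0 ?sqrtr_ge0 //.
rewrite exprMn (sqr_sqrtr (ler0n _ _)) sqr_enorm /dotv.
apply: le_trans (_ : \sum_(i < n) b ^+ 2 <= _).
  apply: ler_sum => i _; rewrite -expr2 -real_normK ?num_real //.
  by rewrite ler_pXn2r ?nnegrE.
by rewrite sumr_const card_ord mulr_natl.
Qed.

Lemma ler_enorm_norm u : enorm u <= Num.sqrt n%:R * `|u|.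
Proof.
apply: enorm_bound_coord => // i.
by rewrite [leRHS]mx_normrE; apply: (le_bigmax _ _ (0, i)).
Qed.

Lemma enorm_mulmx_bound (A : 'M[R]_n) :
  exists2 C : R, 0 < C & forall u, enorm (u *m A) <= C * enorm u.
Proof.
pose c := \sum_(j < n) enorm (row j A^T).
have c0 : 0 <= c by apply: sumr_ge0 => j _; exact: enorm_ge0.
have Cp : 0 <= Num.sqrt n%:R * c by rewrite mulr_ge0 ?sqrtr_ge0.
(* The summand 1 keeps the constant positive even when [A = 0]. *)
exists (Num.sqrt n%:R * c + 1) => [|u]; first lra.
apply: le_trans (_ : Num.sqrt n%:R * (c * enorm u) <= _); last first.
  have := enorm_ge0 u; nra.
apply: enorm_bound_coord => [|j]; first by rewrite mulr_ge0 ?enorm_ge0.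
have -> : (u *m A) 0 j = dotv u (row j A^T).
  by rewrite mxE; apply: eq_bigr => k _; rewrite !mxE.
apply: le_trans (ler_norm_dotv _ _) _; rewrite mulrC ler_wpM2r ?enorm_ge0 //.
by rewrite /c (bigD1 j) //= lerDl; apply: sumr_ge0 => k _; exact: enorm_ge0.
Qed.

Lemma enorm_unitmx_bound (A : 'M[R]_n) : A \in unitmx ->
  exists2 m : R, 0 < m & forall u, m * enorm u <= enorm (u *m A).
Proof.
move=> uA; have [C C0 hC] := enorm_mulmx_bound (invmx A).
exists C^-1 => [|u]; first by rewrite invr_gt0.
by rewrite ler_pdivrMl //; have := hC (u *m A); rewrite mulmxK.
Qed.

(** * Neighborhoods, limits and differentials in the Euclidean norm *)

Lemma near_enorm x (P : set 'rV[R]_n) : (\forall y \near x, P y) ->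
  exists2 e : R, 0 < e & forall y, enorm (y - x) < e -> P y.
Proof.
move/nbhs_ballP => [e /= e0 he]; exists e => // y yx; apply: he.
rewrite -ball_normE /ball_ /= distrC.
exact: le_lt_trans (ler_norm_enorm _) yx.
Qed.

Lemma cvg_enormP {T} {F : set_system T} {FF : Filter F} (w : T -> 'rV[R]_n) x :
  w @ F --> x <-> forall e : R, 0 < e -> \forall t \near F, enorm (w t - x) < e.
Proof.
split => [/cvgrPdist_lt h e e0|h]; last first.
  apply/cvgrPdist_lt => e e0; apply: filterS (h e e0) => t.
  by rewrite distrC; apply: le_lt_trans; exact: ler_norm_enorm.
(* [Num.sqrt n%:R] bounds the Euclidean norm by the sup norm; adding 1 keeps [s] invertible when
   [n = 0]. *)
pose s : R := Num.sqrt n%:R + 1.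
have s0 : 0 < s by rewrite ltr_wpDl ?sqrtr_ge0.
apply: filterS (h (e / s) (divr_gt0 e0 s0)) => t.
rewrite distrC ltr_pdivlMr // => he.
apply: le_lt_trans (ler_enorm_norm _) _; apply: le_lt_trans he.
by rewrite mulrC ler_wpM2l // /s lerDl.
Qed.

Lemma differentiable_enorm (F : 'rV[R]_n -> 'rV[R]_n) x :
  differentiable F x -> forall e : R, 0 < e ->
  exists2 d : R, 0 < d & forall y, enorm (y - x) < d ->
    enorm (F y - F x - (y - x) *m 'J F x) <= e * enorm (y - x).
Proof.
move=> dF e e0; pose s : R := Num.sqrt n%:R + 1.
have s0 : 0 < s by rewrite ltr_wpDl ?sqrtr_ge0.
have /eqaddoP/(_ (e / s) (divr_gt0 e0 s0)) ho := diff_locally dF.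
have [d d0 hd] := near_enorm _ _ ho.
exists d => // y yx.
have := hd (y - x); rewrite subr0 => /(_ yx) /= hy.
have -> : F y - F x - (y - x) *m 'J F x =
    (F \o shift x - (cst (F x) + 'd F x)) (y - x).
  by rewrite /jacobian mul_rV_lin1 !fctE /= subrK opprD addrA.
apply: le_trans (ler_enorm_norm _) _.
apply: le_trans (_ : s * (e / s * `|y - x|) <= _).
  apply: ler_pM => //; rewrite ?sqrtr_ge0 //.
  by rewrite /s lerDl.
rewrite mulrA [s * _]mulrC divfK ?gt_eqF // ler_wpM2l ?(ltW e0) //.
exact: ler_norm_enorm.
Qed.

(** * Lipschitz gradients and the descent lemma *)

Lemma lip_modulusP (F : 'rV[R]_n -> 'rV[R]_n) :
  (exists L, lip_const F L) -> lip_const F (lip_modulus F).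
Proof.
move=> hL; have L0 : 0 <= lip_modulus F by apply: lb_le_inf => // L [].
split=> // x y; have [->|xy] := eqVneq x y.
  by rewrite !subrr !enorm0 mulr0.
have xy0 : 0 < enorm (x - y) by rewrite enorm_gt0 subr_eq0.
(* Each difference quotient is a lower bound of the set of Lipschitz constants, so the infimum is
   itself a Lipschitz constant. *)
rewrite -ler_pdivrMr //; apply: lb_le_inf => // L [_ /(_ x y)].
by rewrite ler_pdivrMr.
Qed.

Lemma diff_dotv_grad (f : 'rV[R]_n -> R) x v : differentiable f x ->
  'D_v f x = dotv (grad f x) v.
Proof.
move=> df; rewrite deriveE // {1}(row_sum_delta v) linear_sum.
by apply: eq_bigr => i _; rewrite linearZ /= mxE deriveE // mulrC.
Qed.

(** The mean value theorem on [0, 1] replaces integration: subtracting the linear and quadratic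
    terms along the segment leaves [h], whose derivative is nonpositive because the gradient moves
    by at most [L * c * enorm v]. *)
Lemma descent_lemma (f : 'rV[R]_n -> R) (L : R) x y :
  (forall z, differentiable f z) -> lip_const (grad f) L ->
  f y <= f x + dotv (grad f x) (y - x) + L / 2 * enorm (y - x) ^+ 2.
Proof.
move=> df [L0 hL]; pose v := y - x.
pose h (t : R) := f (x + t *: v) - t * dotv (grad f x) v
  - t ^+ 2 * (L / 2 * enorm v ^+ 2).
pose dh (t : R) := dotv (grad f (x + t *: v)) v - dotv (grad f x) v
  - 2 * t * (L / 2 * enorm v ^+ 2).
have hh (t : R) : is_derive t 1 h (dh t).
  have h1 : is_derive t 1 (fun t : R => f (x + t *: v)) (dotv (grad f (x + t *: v)) v).
    have e (s : R) : s^-1 *: (f (x + (s *: 1 + t) *: v) - f (x + t *: v)) =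
        s^-1 *: (f (s *: v + (x + t *: v)) - f (x + t *: v)).
      by rewrite addrCA -scalerDl /GRing.scale /= mulr1.
    have dv : derivable f (x + t *: v) v by exact: diff_derivable.
    have E : (fun s : R => s^-1 *: (f (x + (s *: 1 + t) *: v) - f (x + t *: v)))
        = (fun s : R => s^-1 *: (f (s *: v + (x + t *: v)) - f (x + t *: v))).
      by apply/funext.
    have <- := diff_dotv_grad f (x + t *: v) v (df _).
    apply: DeriveDef; first by move: dv; rewrite /derivable -E.
    by rewrite /derive -E.
  rewrite /h /dh; apply: is_derive_eq.
  rewrite /GRing.scale /=; ring.
have [c c01] : exists2 c : R, c \in `]0, 1[%R & h 1 - h 0 = dh c * (1 - 0).
  apply: MVT => //.
  apply: derivable_within_continuous => t _; exact: (@ex_derive _ _ _ _ _ _ _ (hh t)).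
rewrite /h !scale0r !scale1r /v subrKC addr0 -/v => eqh.
suff : dh c <= 0 by move: eqh; lra.
have : dotv (grad f (x + c *: v)) v - dotv (grad f x) v <= L * c * enorm v ^+ 2.
  rewrite -dotvNl -dotvDl; apply: le_trans (ler_dotv_enorm _ _) _.
  rewrite expr2 mulrA ler_wpM2r ?enorm_ge0 //; apply: le_trans (hL _ _) _.
  by rewrite [x + _]addrC addrK enormZ mulrA ger0_norm // (itvP c01).
by rewrite /dh; lra.
Qed.

End Euclidean.

(** * The forward-backward envelope: attainment, lower bound and growth *)

Section Envelope.
Context {R : realType} {n : nat}.
Variables (f : 'rV[R]_n -> R) (g : 'rV[R]_n -> \bar R) (gamma : R).
Hypothesis gamma_gt0 : 0 < gamma.
Hypothesis g_proper : proper_fun g.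
Implicit Types x y z : 'rV[R]_n.

(** The real-valued part of the objective in [fb_envelope], kept apart from [g] so that estimates
    take place in [R]. *)
Definition fb_model x z : R :=
  f x + dotv (grad f x) (z - x) + (2 * gamma)^-1 * enorm (z - x) ^+ 2.

Lemma fb_envelope_le x z : (fb_envelope gamma f g x <= (fb_model x z)%:E + g z)%E.
Proof. by apply: ereal_inf_lbound; exists z. Qed.

Lemma fb_step_fin_num x z : fb_step gamma f g x z -> g z \is a fin_num.
Proof.
case: g_proper => gNy [w gw] /(_ w) /= h.
rewrite fin_numE gNy /= -ltey.
have : (g z + ((2 * gamma)^-1 * enorm (z - (x - gamma *: grad f x)) ^+ 2)%:E < +oo)%E.
  by apply: le_lt_trans h _; exact: lte_add_pinfty (ltry _).
by case: (g z) => // s _; rewrite ltry.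
Qed.

(** Completing the square: the gap between the two objectives does not depend on [z], so points of
    [fb_step] attain the infimum of the envelope. *)
Lemma prox_objE x z : (2 * gamma)^-1 * enorm (z - (x - gamma *: grad f x)) ^+ 2 =
  fb_model x z + (gamma / 2 * enorm (grad f x) ^+ 2 - f x).
Proof.
rewrite /fb_model opprB addrCA; move: (z - x) (grad f x) => w G.
rewrite !sqr_enorm !dotvE (dotvC w G); field.
by rewrite gt_eqF.
Qed.

Lemma fb_envelope_fb_step x z : fb_step gamma f g x z ->
  fb_envelope gamma f g x = ((fb_model x z)%:E + g z)%E.
Proof.
move=> zx; apply/eqP; rewrite eq_le fb_envelope_le /=.
apply: le_ereal_inf_tmp => _ [w _ <-]; move: (zx w) => /=.
rewrite -/(fb_model x w) !prox_objE.
move: (fb_model x z) (fb_model x w) (_ - f x) => a b c.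
by rewrite !EFinD !addeA leeD2rE // addeC [(b%:E + _)%E]addeC.
Qed.

Variable L : R.
Hypothesis df : forall x, differentiable f x.
Hypothesis hL : lip_const (grad f) L.

(** The descent lemma bounds [f z] by the linearization at [x] plus [L / 2] times the squared
    distance; what remains of the proximal term is the surplus. *)
Lemma cost_le_fb_envelope x z : fb_step gamma f g x z ->
  (cost f g z + ((2 * gamma)^-1 * (1 - gamma * L) * enorm (x - z) ^+ 2)%:E
    <= fb_envelope gamma f g x)%E.
Proof.
move=> zx; rewrite (fb_envelope_fb_step _ _ zx) /cost -(fineK (fb_step_fin_num _ _ zx)).
rewrite -!EFinD lee_fin /fb_model (enormBC x).
have := descent_lemma _ _ x z df hL.
have -> : (2 * gamma)^-1 * (1 - gamma * L) * enorm (z - x) ^+ 2 =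
  (2 * gamma)^-1 * enorm (z - x) ^+ 2 - L / 2 * enorm (z - x) ^+ 2.
  by field; rewrite gt_eqF.
lra.
Qed.

(** The minimizer [z] for [x] serves as competitor at [y]. The terms linear in [grad f x] along
    [y - x] cancel, and the change of gradient adds [L] to the [L / 2] of the descent lemma. The
    only term of first order in [y - x] carries the factor [enorm (x - z)], small near a fixed
    point. *)
Lemma fb_envelope_growth x y z : fb_step gamma f g x z ->
  (fb_envelope gamma f g y <= fb_envelope gamma f g x +
    ((3 / 2 * L + (2 * gamma)^-1) * enorm (y - x) ^+ 2
     + (L + gamma^-1) * (enorm (y - x) * enorm (x - z)))%:E)%E.
Proof.
move=> zx; apply: le_trans (fb_envelope_le y z) _.
rewrite (fb_envelope_fb_step _ _ zx) -(fineK (fb_step_fin_num _ _ zx)).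
rewrite -!EFinD lee_fin /fb_model.
have h1 := descent_lemma _ _ x y df hL.
pose v := y - x; pose w := z - x; pose D := grad f y - grad f x.
have -> : z - y = w - v by rewrite /v /w opprB addrA subrK.
have -> : grad f y = grad f x + D by rewrite /D addrC subrK.
rewrite (enormBC x z) -/v -/w in h1 *.
have hD : enorm D <= L * enorm v by case: hL => _; exact.
clearbody v w D.
have hDv : - dotv D v <= L * enorm v ^+ 2.
  rewrite -dotvNl; apply: le_trans (ler_dotv_enorm _ _) _.
  by rewrite enormN expr2 mulrA ler_wpM2r ?enorm_ge0.
have hDw : dotv D w <= L * (enorm v * enorm w).
  apply: le_trans (ler_dotv_enorm _ _) _.
  by rewrite mulrA ler_wpM2r ?enorm_ge0.
have hvw : gamma^-1 * - dotv w v <= gamma^-1 * (enorm v * enorm w).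
  rewrite ler_pM2l ?invr_gt0 // -dotvNr mulrC -(enormN v).
  exact: ler_dotv_enorm.
have -> : (2 * gamma)^-1 * enorm (w - v) ^+ 2 = (2 * gamma)^-1 * enorm w ^+ 2
    + gamma^-1 * - dotv w v + (2 * gamma)^-1 * enorm v ^+ 2.
  by rewrite !sqr_enorm !dotvE (dotvC v w); field; rewrite gt_eqF.
rewrite !dotvE; lra.
Qed.

End Envelope.

(** * Strong minima: growth of the envelope and nonsingularity of the Jacobian *)

Section StrongMinimum.
Context {R : realType} {n : nat}.
Variables (f : 'rV[R]_n -> R) (g : 'rV[R]_n -> \bar R) (gamma L : R).
Hypothesis gamma_gt0 : 0 < gamma.
Hypothesis g_proper : proper_fun g.
Hypothesis df : forall x, differentiable f x.
Hypothesis hL : lip_const (grad f) L.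
Hypothesis gammaL : gamma * L < 1.
Variable xs : 'rV[R]_n.
Hypothesis cost_xs : cost f g xs \is a fin_num.
Hypothesis xs_min : strong_local_min (cost f g) xs.
Implicit Types x y z : 'rV[R]_n.

Lemma fb_residual_fb_step x r : fb_residual gamma f g x r ->
  fb_step gamma f g x (x - gamma *: r).
Proof.
by case=> z zx <-; rewrite scalerA divff ?gt_eqF // scale1r opprB addrC subrK.
Qed.

(** The growth of the cost at [z] and the surplus in [enorm (x - z)] add up; both have weight at
    least [m], and half the square of a sum is at most the sum of squares, whence [m / 2]. *)
Lemma fb_envelope_strong_min : exists c e : R, [/\ 0 < c, 0 < e &
  forall x z, fb_step gamma f g x z -> enorm (z - xs) < e ->
    (cost f g xs + (c * enorm (x - xs) ^+ 2)%:E <= fb_envelope gamma f g x)%E].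
Proof.
case: xs_min => c c0 /near_enorm[e e0 he].
pose k := (2 * gamma)^-1 * (1 - gamma * L).
have k0 : 0 < k by rewrite mulr_gt0 ?invr_gt0 ?mulr_gt0 ?subr_gt0.
pose m := Num.min c k.
have m0 : 0 < m by rewrite lt_min c0 k0.
exists (m / 2), e; split=> // [|x z zx zxs]; first by rewrite divr_gt0.
apply: le_trans (cost_le_fb_envelope _ _ _ gamma_gt0 g_proper _ df hL _ _ zx).
apply: le_trans (leeD (he z zxs) (lexx _)).
rewrite -(fineK cost_xs) -!EFinD lee_fin -addrA lerD2l -/k.
have mc : m <= c by rewrite ge_min lexx.
have mk : m <= k by rewrite ge_min lexx orbT.
have tri : enorm (x - xs) <= enorm (z - xs) + enorm (x - z).
  by rewrite [leRHS]addrC; have := ler_enormD (x - z) (z - xs); rewrite addrA subrK.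
have := enorm_ge0 (x - xs); have := enorm_ge0 (z - xs); have := enorm_ge0 (x - z).
move: (enorm (x - xs)) (enorm (z - xs)) (enorm (x - z)) tri => a b d tri d0 b0 a0.
apply: le_trans (_ : m * (b ^+ 2 + d ^+ 2) <= _); last first.
  by rewrite mulrDr; apply: lerD; apply: ler_wpM2r; rewrite ?sqr_ge0.
rewrite -mulrA ler_wpM2l ?(ltW m0) //.
have : a ^+ 2 <= (b + d) ^+ 2 by rewrite ler_pXn2r ?nnegrE ?addr_ge0.
have := sqr_ge0 (b - d); rewrite sqrrB sqrrD; lra.
Qed.

(* If [u *m 'J res xs = 0], the residual is o(t) along [xs + t *: u].  Walking
   from [xs] to [xs + t *: u] in [N] equal steps, [fb_envelope_growth] then
   bounds the increase of the envelope by (C / N) t^2 + o(t^2), which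
   contradicts its quadratic growth once [N] is large. *)
Lemma jacobian_residual_unitmx (res : 'rV[R]_n -> 'rV[R]_n) :
  (\forall y \near xs, fb_residual gamma f g y = [set res y]) ->
  differentiable res xs -> res xs = 0 -> 'J res xs \in unitmx.
Proof.
move=> /near_enorm[e1 e10 hres] dres res0.
have [c [e2 [c0 e20 hc]]] := fb_envelope_strong_min.
(* The Jacobian acts on row vectors from the right, so it suffices that every row of its left kernel
   vanishes. *)
rewrite -row_free_unit -kermx_eq0; apply/eqP/row_matrixP => i; rewrite row0.
set u := row i _.
have uJ : u *m 'J res xs = 0 by rewrite -row_mul mulmx_ker row0.
apply/eqP/negPn/negP => u0; have {u0}nu : 0 < enorm u by rewrite enorm_gt0.
clearbody u.
pose A := 3 / 2 * L + (2 * gamma)^-1; pose B := L + gamma^-1.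
have L0 : 0 <= L by case: hL.
have A0 : 0 < A by rewrite ltr_wpDl ?invr_gt0 ?mulr_gt0 // mulr_ge0 // divr_ge0.
have B0 : 0 < B by rewrite ltr_wpDl ?invr_gt0.
(* Makes [B * gamma * eps] equal to [c / 4]; with [A / N.+1%:R <= c / 4] below, the total increase
   is at most half of what growth demands. *)
pose eps := c / 4 / (B * gamma).
have eps0 : 0 < eps by rewrite !divr_gt0 ?mulr_gt0.
have [e3 e30 hJ] := differentiable_enorm _ _ dres _ eps0.
have [N AN] : exists N : nat, A / N.+1%:R <= c / 4.
  exists (Num.truncn (A / (c / 4))); rewrite ler_pdivrMr // mulrC -ler_pdivrMr ?divr_gt0 //.
  by apply: ltW; apply: truncnS_gt.
pose e := Num.min e1 (Num.min e2 e3).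
have e0 : 0 < e by rewrite !lt_min e10 e20 e30.
have [le1 le2 le3] : [/\ e <= e1, e <= e2 & e <= e3].
  by rewrite !ge_min !lexx !orbT.
have ge0 : 0 < 1 + gamma * eps by apply: addr_gt0 => //; apply: mulr_gt0.
(* The walk has length [q]. The factor [1 + gamma * eps] keeps also the forward-backward image of
   its endpoint within [e] of [xs], and the 2 makes this strict. *)
pose q := e / 2 / (1 + gamma * eps).
have q0 : 0 < q by rewrite !divr_gt0.
have qe : q * (1 + gamma * eps) < e by rewrite divfK ?gt_eqF //; lra.
have qe' : q < e by apply: le_lt_trans qe; rewrite ler_peMr ?(ltW q0) // lerDl; apply: mulr_ge0; exact: ltW.
clearbody q.
pose y (j : nat) := xs + (j%:R / N.+1%:R * (q / enorm u)) *: u.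
have yxs j : enorm (y j - xs) = j%:R / N.+1%:R * q.
  rewrite /y [xs + _]addrC addrK enormZ ger0_norm ?mulr_ge0 ?invr_ge0 ?(ltW q0) ?enorm_ge0 //.
  by rewrite mulrA divfK ?gt_eqF.
have yxsq j : (j <= N.+1)%N -> enorm (y j - xs) <= q.
  by move=> jN; rewrite yxs ler_piMl ?(ltW q0) // ler_pdivrMr // mul1r ler_nat.
have yS j : enorm (y j.+1 - y j) = q / N.+1%:R.
  rewrite /y opprD addrACA subrr add0r -scalerBl -mulrBl -mulrBl -natrB // subSnn.
  rewrite enormZ ger0_norm ?mulr_ge0 ?invr_ge0 ?(ltW q0) ?enorm_ge0 //.
  by rewrite mulrA divfK ?gt_eqF // mul1r mulrC.
have step j : (j <= N.+1)%N -> fb_step gamma f g (y j) (y j - gamma *: res (y j)).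
  move=> jN; apply: fb_residual_fb_step; rewrite hres //.
  by apply: lt_le_trans le1; apply: le_lt_trans qe'; exact: yxsq.
have resle j : (j <= N.+1)%N -> enorm (res (y j)) <= eps * q.
  move=> jN; have := hJ (y j); rewrite res0 subr0.
  have -> : (y j - xs) *m 'J res xs = 0.
    by rewrite /y [xs + _]addrC addrK -scalemxAl uJ scaler0.
  rewrite subr0 => h; apply: le_trans (h _) _.
    by apply: lt_le_trans le3; apply: le_lt_trans qe'; exact: yxsq.
  by rewrite ler_wpM2l ?(ltW eps0) ?yxsq.
(* Bound for the increase over one step of length [q / N.+1%:R], starting where the forward-backward
   displacement is at most [gamma * (eps * q)]. *)
pose s := A * (q / N.+1%:R) ^+ 2 + B * (q / N.+1%:R * (gamma * (eps * q))).
have chain j : (j <= N.+1)%N ->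
    (fb_envelope gamma f g (y j) <= cost f g xs + (j%:R * s)%:E)%E.
  elim: j => [_|j IH jN].
    rewrite mul0r adde0 /y mul0r mul0r scale0r addr0.
    apply: le_trans (fb_envelope_le _ _ _ _ xs) _.
    by rewrite /fb_model subrr -(scale0r 0) dotvZr enormZ normr0 !mul0r expr0n /= mulr0 !addr0.
  have := fb_envelope_growth _ _ _ gamma_gt0 g_proper _ df hL _ (y j.+1) _ (step j (ltnW jN)).
  move=> h; apply: le_trans h _; apply: le_trans (leeD (IH (ltnW jN)) (lexx _)) _.
  have -> : j.+1%:R = j%:R + 1 :> R by rewrite -natr1.
  rewrite -addeA leeD2l // -EFinD lee_fin [(_ + 1) * s]mulrDl mul1r lerD2l yS /s -/A -/B.
  rewrite lerD2l ler_wpM2l ?(ltW B0) // ler_wpM2l ?divr_ge0 ?(ltW q0) //.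
  rewrite opprB addrC subrK enormZ gtr0_norm // ler_wpM2l ?(ltW gamma_gt0) //.
  exact: resle (ltnW jN).
have := le_trans (hc _ _ (step _ (leqnn _)) _) (chain _ (leqnn _)).
rewrite -(fineK cost_xs) -!EFinD lee_fin lerD2l yxs divff ?pnatr_eq0 // mul1r.
have -> : N.+1%:R * s = (A / N.+1%:R + B * gamma * eps) * q ^+ 2.
  have : N.+1%:R != 0 :> R by rewrite pnatr_eq0.
  by rewrite /s; move: (N.+1%:R) => M M0; field.
have -> : B * gamma * eps = c / 4.
  by rewrite /eps mulrC divfK // gt_eqF ?mulr_gt0.
(* After division by [q ^+ 2], growth forces [c <= c / 4 + c / 4], impossible for positive [c]. *)
rewrite ler_pM2r ?exprn_gt0 // => h; suff : c <= A / N.+1%:R + c / 4.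
  by move: AN; move: (A / _) => a; lra.
apply: h; apply: lt_le_trans le2; apply: le_lt_trans qe.
rewrite addrAC; apply: le_trans (ler_enormB _ _) _; rewrite enormZ gtr0_norm //.
rewrite mulrDr mulr1 lerD ?yxsq // [leRHS]mulrCA [q * _]mulrC.
by rewrite ler_wpM2l ?(ltW gamma_gt0) ?resle.
Qed.

End StrongMinimum.

Lemma superlinearP {R : realType} {n : nat} (w : nat -> 'rV[R]_n) ws :
  (\forall k \near \oo, w k <> ws) ->
  (forall e : R, 0 < e ->
    \forall k \near \oo, enorm (w k.+1 - ws) <= e * enorm (w k - ws)) ->
  superlinear w ws.
Proof.
move=> wne h; split=> //; apply/cvgrPdist_le => e e0.
near=> k; rewrite sub0r normrN ger0_norm ?mulr_ge0 ?invr_ge0 ?enorm_ge0 //.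
rewrite ler_pdivrMr; first by near: k; exact: h.
by rewrite enorm_gt0 subr_eq0; apply/eqP; near: k.
Unshelve. all: by end_near. Qed.

(** * Descent properties of the ZeroFPR iterates *)

Section ZeroFPR.
Context {R : realType} {n : nat}.
Variables (f : 'rV[R]_n -> R) (g : 'rV[R]_n -> \bar R).
Variables (gamma beta pmin sigma : R) (p : nat -> R).
Variables (x xbar r d : nat -> 'rV[R]_n) (tau : nat -> R) (Phi : nat -> \bar R).
Hypothesis hfg : standing f g.
Hypothesis halg : ZeroFPR f g gamma beta pmin sigma p x xbar r d tau Phi.

Local Notation L := (lip_modulus (grad f)).

Lemma zfpr_lip_const : lip_const (grad f) L.
Proof. exact: lip_modulusP (standing_lipschitz hfg). Qed.

Lemma zfpr_gamma_lip : gamma * L < 1.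
Proof.
have [L0 _] := zfpr_lip_const.
have := zfpr_gamma_lt halg; rewrite lt_min => /andP[+ _].
have [->|Ln0] := eqVneq L 0; first by rewrite mulr0.
by rewrite inver (negPf Ln0) lte_fin -[L^-1]mul1r ltr_pdivlMr // lt_def Ln0.
Qed.

Lemma zfpr_sub k : x k - xbar k = gamma *: r k.
Proof.
by rewrite (zfpr_r halg) scalerA divff ?scale1r // gt_eqF // (zfpr_gamma_gt0 halg).
Qed.

Lemma zfpr_tau_accepted k :
  (fb_envelope gamma f g (x k.+1) <= Phi k - (sigma * enorm (r k) ^+ 2)%:E)%E.
Proof. by rewrite (zfpr_x halg); have [m [-> + _]] := zfpr_tau halg k. Qed.

Lemma fb_envelope_zfpr_fin_num k : fb_envelope gamma f g (x k) \is a fin_num.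
Proof.
have xk := zfpr_xbar halg k; have gp := standing_proper hfg.
have g0 := zfpr_gamma_gt0 halg.
by rewrite (fb_envelope_fb_step _ _ _ g0 _ _ xk) fin_numD (fb_step_fin_num _ _ _ gp _ _ xk).
Qed.

(** [Phi k.+1] averages [Phi k] with an envelope value lower by at least [sigma * enorm (r k) ^+ 2].
    It therefore stays above that value and drops by at least the fraction [pmin] of this
    decrease. *)
Lemma zfpr_merit : exists P : nat -> R, forall k,
  [/\ Phi k = (P k)%:E, (fb_envelope gamma f g (x k) <= (P k)%:E)%E &
      P k.+1 <= P k - pmin * (sigma * enorm (r k) ^+ 2)].
Proof.
pose e k := fine (fb_envelope gamma f g (x k)).
have eE k : fb_envelope gamma f g (x k) = (e k)%:E.
  by rewrite fineK // fb_envelope_zfpr_fin_num.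
exists (fun k => fine (Phi k)).
have PE k : Phi k \is a fin_num.
  elim: k => [|k IH]; first by rewrite (zfpr_Phi0 halg) eE.
  by rewrite (zfpr_Phi halg) eE -(fineK IH).
have acc k : e k.+1 <= fine (Phi k) - sigma * enorm (r k) ^+ 2.
  by rewrite -lee_fin EFinB (fineK (PE k)) -eE zfpr_tau_accepted.
have sig0 : 0 < sigma by case/andP: (zfpr_sigma halg).
have s0 k : 0 <= sigma * enorm (r k) ^+ 2 by rewrite mulr_ge0 ?sqr_ge0 ?(ltW sig0).
have PS k : fine (Phi k.+1) = (1 - p k) * fine (Phi k) + p k * e k.+1.
  by rewrite (zfpr_Phi halg) eE -{1}(fineK (PE k)).
move=> k; rewrite (fineK (PE k)).
have /andP[pm p1] := zfpr_p halg k; have /andP[pm0 _] := zfpr_pmin halg.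
split=> //; last by rewrite PS; have := acc k; have := s0 k; nra.
case: k {pm p1} => [|k]; first by rewrite (zfpr_Phi0 halg).
rewrite -(fineK (PE _)) eE lee_fin PS.
have /andP[pm p1] := zfpr_p halg k.
by have := acc k; have := s0 k; nra.
Qed.

(** The merit values are nonincreasing and bounded below by the minimal cost, so their decrements,
    which dominate the squared residuals, tend to 0. *)
Lemma zfpr_residual_cvg0 : r @ \oo --> (0 : 'rV[R]_n).
Proof.
have [P hP] := zfpr_merit.
have [a amin] := standing_argmin hfg.
have gp := standing_proper hfg; have g0 := zfpr_gamma_gt0 halg.
have sig0 : 0 < sigma by case/andP: (zfpr_sigma halg).
have /andP[pm0 _] := zfpr_pmin halg.
have ps0 : 0 < pmin * sigma by rewrite mulr_gt0.
have lb k : (cost f g a <= (P k)%:E)%E.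
  have [_ + _] := hP k; apply: le_trans.
  have xk := zfpr_xbar halg k.
  apply: le_trans (cost_le_fb_envelope _ _ _ g0 gp _ (standing_differentiable hfg)
    zfpr_lip_const _ _ xk).
  apply: le_trans (amin (xbar k)) _.
  rewrite leeDl // lee_fin; apply: mulr_ge0 (sqr_ge0 _); apply: mulr_ge0.
    by rewrite invr_ge0 mulr_ge0 ?(ltW g0).
  by rewrite subr_ge0 (ltW zfpr_gamma_lip).
have cfin : exists m : R, forall k, m <= P k.
  have [/(_ a) gNy _] := gp; move: lb gNy; rewrite /cost.
  case: (g a) => [s h _|/(_ 0%N)|] //.
  by exists (f a + s) => k; rewrite -lee_fin EFinD.
have Pdec k : P k.+1 <= P k.
  have [_ _] := hP k; have := sqr_ge0 (enorm (r k)); nra.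
have cP : cvgn P.
  apply: nonincreasing_is_cvgn; first exact/nonincreasing_seqP.
  by have [m hm] := cfin; exists m => _ [k _ <-].
have cdiff : (P k - P k.+1) @[k --> \oo] --> (0 : R).
  rewrite -(subrr (limn P)); apply: cvgB => //.
  by have := cP; rewrite -(cvg_shiftS P).
apply/cvg_enormP => e e0.
have := cdiff; move/cvgrPdist_lt/(_ (pmin * sigma * e ^+ 2)).
rewrite mulr_gt0 ?exprn_gt0 // => /(_ isT); apply: filterS => k.
rewrite sub0r normrN subr0 => h.
rewrite -(@ltr_pXn2r _ 2) ?nnegrE ?enorm_ge0 ?(ltW e0) //.
rewrite -(ltr_pM2l ps0); apply: le_lt_trans h.
apply: le_trans (ler_norm _); have [_ _] := hP k; lra.
Qed.

(** The trial step 1 is [beta ^+ 0], the largest of all candidates. *)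
Lemma zfpr_unit_step k :
  (fb_envelope gamma f g (xbar k + d k) <= Phi k - (sigma * enorm (r k) ^+ 2)%:E)%E ->
  tau k = 1.
Proof.
move=> acc; have [m [-> _ /(_ 0%N)]] := zfpr_tau halg k.
rewrite expr0 scale1r => /(_ acc) le1; apply/eqP; rewrite eq_le le1 andbT.
by have /andP[b0 b1] := zfpr_beta halg; rewrite exprn_ile1 ?ltW.
Qed.

(** Since [x k - xbar k] is [gamma *: r k], the surplus in [cost_le_fb_envelope] is
    [gamma * (1 - gamma * L) / 2] times the squared residual, and [sigma] lies below this factor. *)
Lemma cost_zfpr_le k :
  (cost f g (xbar k) <= Phi k - (sigma * enorm (r k) ^+ 2)%:E)%E.
Proof.
have [P /(_ k) [PE eP _]] := zfpr_merit.
have gp := standing_proper hfg; have g0 := zfpr_gamma_gt0 halg.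
have xk := zfpr_xbar halg k.
have := cost_le_fb_envelope _ _ _ g0 gp _ (standing_differentiable hfg)
    zfpr_lip_const _ _ xk.
rewrite PE leeBrDr // => h; apply: le_trans eP; apply: le_trans h.
rewrite leeD2l // lee_fin zfpr_sub enormZ gtr0_norm // exprMn [leRHS]mulrA.
rewrite ler_wpM2r ?sqr_ge0 //; have /andP[_ /ltW] := zfpr_sigma halg.
move=> /le_trans; apply; rewrite le_eqVlt; apply/orP; left; apply/eqP.
by field; rewrite gt_eqF.
Qed.

End ZeroFPR.

(** * Acceptance of unit steps and superlinear rates *)

Theorem theorem5p10 (R : realType) (n : nat)
    (f : 'rV[R]_n -> R) (g : 'rV[R]_n -> \bar R)
    (gamma beta pmin sigma : R) (p : nat -> R)
    (x xbar r d : nat -> 'rV[R]_n) (tau : nat -> R) (Phi : nat -> \bar R)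
    (xstar : 'rV[R]_n) (J : 'M[R]_n) (rbar : nat -> 'rV[R]_n)
    (hfg : standing f g)
    (halg : ZeroFPR f g gamma beta pmin sigma p x xbar r d tau Phi)
    (hA2 : A2_strict f g xstar)
    (hmin : strong_local_min (cost f g) xstar)
    (hx : x @ \oo --> xstar)
    (hJ : has_jacobian (fb_residual gamma f g) xstar J)
    (hrbar : forall k, fb_residual gamma f g (xbar k) (rbar k))
    (hDM : dennis_more J rbar d) :
  (\forall k \near \oo, tau k = 1) /\
  superlinear x xstar /\ superlinear xbar xstar /\ superlinear r 0.
Proof.
have gp := standing_proper hfg; have g0 := zfpr_gamma_gt0 halg.
have df := standing_differentiable hfg.
have hL := zfpr_lip_const _ _ hfg.
have gL := zfpr_gamma_lip _ _ _ _ _ _ _ _ _ _ _ _ _ hfg halg.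
have costfin : cost f g xstar \is a fin_num.
  have [lty _] := A2_critical hA2; rewrite fin_numE -ltey lty andbT.
  by rewrite /cost; have [/(_ xstar)] := gp; case: (g xstar).
case: hJ => res [hres dres JE]; subst J.
have [e1 e10 hres1] := near_enorm _ _ hres.
have hxe e : 0 < e -> \forall k \near \oo, enorm (x k - xstar) < e.
  by move=> e0; move/cvg_enormP: hx; exact.
have rE k : fb_residual gamma f g (x k) (r k).
  by exists (xbar k); [exact: (zfpr_xbar halg) | rewrite (zfpr_r halg)].
have rres : \forall k \near \oo, r k = res (x k).
  apply: filterS (hxe e1 e10) => k xk.
  by have := rE k; rewrite hres1.
have rcvg := zfpr_residual_cvg0 _ _ _ _ _ _ _ _ _ _ _ _ _ hfg halg.
(* [res (x k)] tends to [res xstar] by continuity and, being eventually [r k], also to 0. *)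
have res0 : res xstar = 0.
  have : (res \o x) @ \oo --> res xstar.
    exact: (continuous_cvg _ (differentiable_continuous dres) hx).
  move=> h; apply/esym/(cvg_unique _ _ h) => //.
  apply: cvg_trans rcvg; apply: near_eq_cvg.
  by apply: filterS rres => k /= ->.
have uJ : 'J res xstar \in unitmx.
  exact: (jacobian_residual_unitmx _ _ _ _ g0 gp df hL gL _ costfin hmin).
have [m m0 hm] := enorm_unitmx_bound _ uJ.
have [M M0 hM] := enorm_mulmx_bound ('J res xstar).
have hdiff e : 0 < e -> exists2 dl : R, 0 < dl & forall y, enorm (y - xstar) < dl ->
    enorm (res y - (y - xstar) *m 'J res xstar) <= e * enorm (y - xstar).
  by move=> /(differentiable_enorm _ _ dres)[dl dl0 h]; exists dl => // y /h; rewrite res0 subr0.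
(* The accuracies 1 and [m / 2] yield the two-sided bound by [M + 1] and [m / 2]: near [xstar] the
   residual is comparable to the distance. *)
have [e2 e20 hres2] := hdiff 1 ltr01.
have [e3 e30 hres3] := hdiff (m / 2) (divr_gt0 m0 (ltr0n _ 2)).
have resU y : enorm (y - xstar) < e2 -> enorm (res y) <= (M + 1) * enorm (y - xstar).
  move=> /hres2 h; have := ler_enormD (res y - (y - xstar) *m 'J res xstar)
    ((y - xstar) *m 'J res xstar).
  rewrite subrK; have := hM (y - xstar); lra.
have resL y : enorm (y - xstar) < e3 -> m / 2 * enorm (y - xstar) <= enorm (res y).
  move=> /hres3; rewrite enormBC => h.
  have := ler_enormD ((y - xstar) *m 'J res xstar - res y) (res y).
  rewrite subrK; have := hm (y - xstar); lra.
pose K := 1 + gamma * (M + 1).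
have K0 : 0 < K by rewrite addr_gt0 // mulr_gt0 // addr_gt0.
have barK : \forall k \near \oo, enorm (xbar k - xstar) <= K * enorm (x k - xstar).
  near=> k.
  have -> : xbar k - xstar = (x k - xstar) - gamma *: r k.
    by rewrite -(zfpr_sub _ _ _ _ _ _ _ _ _ _ _ _ _ halg) opprB [RHS]addrC subrKA.
  apply: le_trans (ler_enormB _ _) _; rewrite enormZ gtr0_norm // mulrDl mul1r lerD2l.
  rewrite -mulrA ler_pM2l //.
  have -> : r k = res (x k) by near: k.
  by apply: resU; near: k; exact: hxe.
have hbar e : 0 < e -> \forall k \near \oo, enorm (xbar k - xstar) < e.
  move=> e0; near=> k; have h : enorm (xbar k - xstar) <= K * enorm (x k - xstar) by near: k.
  apply: le_lt_trans h _; rewrite mulrC -ltr_pdivlMr //.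
  by near: k; apply: hxe; rewrite divr_gt0.
have [dne0 dm] := hDM.
have dm' e : 0 < e -> \forall k \near \oo,
    enorm (rbar k + d k *m 'J res xstar) <= e * enorm (d k).
  move=> e0; near=> k.
  have d0 : 0 < enorm (d k) by rewrite enorm_gt0; apply/eqP; near: k.
  rewrite -ler_pdivrMr //; apply: le_trans (ler_norm _) _.
  rewrite -normrN -[X in `|X|]sub0r; near: k.
  by move/cvgrPdist_le: dm; apply.
have newton e : 0 < e -> \forall k \near \oo,
    enorm (xbar k + d k - xstar) <= e * enorm (xbar k - xstar).
  (* With [W] and [B] the distances after and before the full step, the estimate will read
     [m * W <= a * (W + 2 * B)]. The first bound on [a] absorbs [W] into the left side, the second
     leaves [e * B]. *)
  move=> e0; pose a := Num.min (m / 2) (m * e / 4).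
  have a0 : 0 < a by rewrite lt_min !divr_gt0 // mulr_gt0.
  have am : a <= m / 2 by rewrite ge_min lexx.
  have ae : a <= m * e / 4 by rewrite ge_min lexx orbT.
  have [dl dl0 hdl] := hdiff a a0.
  near=> k.
  have xk1 : enorm (xbar k - xstar) < e1 by near: k; exact: hbar.
  have xkd : enorm (xbar k - xstar) < dl by near: k; exact: hbar.
  have rb : rbar k = res (xbar k) by have := hrbar k; rewrite hres1.
  have hk : enorm (rbar k + d k *m 'J res xstar) <= a * enorm (d k).
    by near: k; exact: dm'.
  have hr := hdl _ xkd; rewrite -rb in hr.
  have := hm (xbar k + d k - xstar).
  (* The Dennis-More error minus the linearization error of [res] at [xbar k]. *)
  have -> : (xbar k + d k - xstar) *m 'J res xstar = (rbar k + d k *m 'J res xstar)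
      - (rbar k - (xbar k - xstar) *m 'J res xstar).
    rewrite addrAC mulmxDl; move: (d k *m _) ((xbar k - _) *m _) => u v.
    by rewrite opprB [rbar k + u]addrC [v - _]addrC addrA addrK addrC.
  move=> /le_trans/(_ (ler_enormB _ _)) h1.
  have h2 : enorm (d k) <= enorm (xbar k + d k - xstar) + enorm (xbar k - xstar).
    have dE : d k = (xbar k + d k - xstar) - (xbar k - xstar).
      by rewrite [xbar k + _ - _]addrAC [RHS]addrC addKr.
    by rewrite {1}dE; exact: ler_enormB.
  have n1 := enorm_ge0 (xbar k + d k - xstar); have n2 := enorm_ge0 (xbar k - xstar).
  have {}h1 : m * enorm (xbar k + d k - xstar) <=
      a * (enorm (xbar k + d k - xstar) + 2 * enorm (xbar k - xstar)).
    have := ler_wpM2l (ltW a0) h2; lra.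
  move: (enorm (xbar k + d k - xstar)) (enorm (xbar k - xstar)) n1 n2 h1 => W B W0 B0 h1.
  rewrite -(ler_pM2l m0); have := ler_wpM2r W0 am; have := ler_wpM2r B0 ae; lra.
have barne : \forall k \near \oo, xbar k <> xstar.
  (* If [xbar k] were [xstar], the Newton estimate would force [d k = 0]. *)
  near=> k => eq; have : d k <> 0 by near: k.
  have : enorm (xbar k + d k - xstar) <= 1 * enorm (xbar k - xstar).
    by near: k; exact: newton.
  rewrite eq subrr enorm0 mulr0 [xstar + _]addrC addrK => d0; apply.
  by apply/eqP; rewrite -enorm_eq0 eq_le d0 enorm_ge0.
have unit_step : \forall k \near \oo, tau k = 1.
  case: hmin => c c0 /near_enorm[e4 e40 hc].
  pose C := 3 / 2 * lip_modulus (grad f) + (2 * gamma)^-1.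
  have C0 : 0 < C.
    by rewrite ltr_wpDl ?invr_gt0 ?mulr_gt0 // mulr_ge0 ?divr_ge0 //; case: hL.
  (* Chosen so that [C * e ^+ 2 <= c]: growth of the envelope after the full step is then covered by
     the strong minimality at [xbar k]. *)
  pose e := Num.min 1 (c / C).
  have e0 : 0 < e by rewrite lt_min ltr01 divr_gt0.
  have Cec : C * e ^+ 2 <= c.
    have ec : C * e <= c by rewrite mulrC -ler_pdivlMr // ge_min lexx orbT.
    have e1' : e <= 1 by rewrite ge_min lexx.
    by rewrite expr2 mulrA; apply: le_trans ec; rewrite ler_piMr // mulr_ge0 ?ltW.
  near=> k.
  apply: (zfpr_unit_step _ _ _ _ _ _ _ _ _ _ _ _ _ halg).
  apply: le_trans (cost_zfpr_le _ _ _ _ _ _ _ _ _ _ _ _ _ hfg halg k).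
  have h4 : enorm (xbar k - xstar) < e4 by near: k; exact: hbar.
  apply: le_trans (hc _ h4).
  (* As [xstar] is a fixed point, the mixed term of [fb_envelope_growth] vanishes and the bound from
     [xstar] is purely quadratic. *)
  have step0 : fb_step gamma f g xstar xstar.
    have := fb_residual_fb_step f g gamma g0 xstar 0.
    rewrite scaler0 subr0; apply; rewrite hres1 ?subrr ?enorm0 // res0 //.
  have := fb_envelope_growth _ _ _ g0 gp _ df hL _ (xbar k + d k) _ step0.
  rewrite subrr enorm0 !mulr0 addr0 -/C => /le_trans; apply.
  apply: leeD.
    apply: le_trans (fb_envelope_le _ _ _ _ xstar) _.
    by rewrite /fb_model subrr -(scale0r 0) dotvZr enormZ normr0 !mul0r expr0n /= mulr0 !addr0.
  rewrite lee_fin; apply: le_trans (_ : C * (e * enorm (xbar k - xstar)) ^+ 2 <= _).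
    rewrite ler_pM2l // ler_pXn2r ?nnegrE ?enorm_ge0 // ?mulr_ge0 ?enorm_ge0 ?(ltW e0) //.
    by near: k; exact: newton.
  by rewrite exprMn mulrA ler_wpM2r ?sqr_ge0.
have xS : \forall k \near \oo, x k.+1 = xbar k + d k.
  by apply: filterS unit_step => k t1; rewrite (zfpr_x halg) t1 scale1r.
have xbarx e : 0 < e -> \forall k \near \oo,
    enorm (x k.+1 - xstar) <= e * enorm (xbar k - xstar).
  move=> e0; near=> k; have -> : x k.+1 = xbar k + d k by near: k.
  by near: k; exact: newton.
have nearS (P : nat -> Prop) : (\forall k \near \oo, P k) -> \forall k \near \oo, P k.+1.
  by case=> N _ hN; exists N => // k /= Nk; apply: hN; exact: leqW.
have slx e : 0 < e -> \forall k \near \oo,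
    enorm (x k.+1 - xstar) <= e * enorm (x k - xstar).
  move=> e0; near=> k.
  apply: le_trans (_ : e / K * enorm (xbar k - xstar) <= _).
    by near: k; apply: xbarx; rewrite divr_gt0.
  apply: le_trans (_ : e / K * (K * enorm (x k - xstar)) <= _).
    by rewrite ler_pM2l ?divr_gt0 //; near: k.
  by rewrite mulrA divfK ?gt_eqF.
split=> //; split; [|split].
- apply: superlinearP => //; near=> k => eq.
  have : r k = res (x k) by near: k.
  by rewrite eq res0; exact: (zfpr_nonstop halg).
- apply: superlinearP => // e e0; near=> k.
  apply: le_trans (_ : K * enorm (x k.+1 - xstar) <= _).
    by near: k; exact: nearS barK.
  rewrite mulrC -ler_pdivlMr // mulrAC.
  by near: k; apply: xbarx; rewrite divr_gt0.
- apply: superlinearP => [|e e0].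
    by apply: nearW => k; exact: (zfpr_nonstop halg).
  near=> k; rewrite !subr0.
  have -> : r k = res (x k) by near: k.
  have -> : r k.+1 = res (x k.+1) by near: k; exact: nearS rres.
  (* The rate of [x] transfers to [r] by the upper residual bound at [x k.+1] and the lower one at
     [x k]. *)
  apply: le_trans (resU _ _) _; first by near: k; exact: (nearS _ (hxe _ e20)).
  apply: le_trans (_ : e * (m / 2 * enorm (x k - xstar)) <= _); last first.
    by rewrite ler_pM2l // resL //; near: k; exact: hxe.
  rewrite mulrA mulrC -ler_pdivlMr ?addr_gt0 // mulrAC; near: k.
  by apply: slx; rewrite !(mulr_gt0, divr_gt0, invr_gt0, addr_gt0).
Unshelve. all: by end_near. Qed.
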